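(* For every triangle $ABC$ with $AB = AC$ and $AC > BC$ (i.e. $b = c > a$), the following triangle centers are at strictly increasing distances from vertex $A$, in this order (each listed center is strictly closer to $A$ than the next one): $$X_{20}, X_{22}, X_8, X_3, X_9, X_{10}, X_{21}, X_2, X_5, X_{12}, X_{17}, X_1, X_{13}, X_7, X_6, X_4, X_{27}, X_{19}, X_{28}, X_{25}, X_{11}, X_{14}, X_{16}, X_{23}.$$ Equivalently, in the isosceles order $\prec$, $X_{20}\prec X_{22}\prec X_8\prec X_3\prec X_9\prec X_{10}\prec X_{21}\prec X_2\prec X_5\prec X_{12}\prec X_{17}\prec X_1\prec X_{13}\prec X_7\prec X_6\prec X_4\prec X_{27}\prec X_{19}\prec X_{28}\prec X_{25}\prec X_{11}\prec X_{14}\prec X_{16}\prec X_{23}$.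
   Context: $X_n$ denotes the $n$-th triangle center listed in Kimberling's Encyclopedia of Triangle Centers (ETC), given there by its barycentric coordinates as functions of the side lengths $a=BC$, $b=CA$, $c=AB$. An isosceles triangle $ABC$ with base $BC$ (so $b=c$) is called tall if $b>a$. The isosceles order on triangle centers is defined by: $P\prec Q$ if $P$ is closer to $A$ than $Q$ in every tall isosceles triangle $ABC$ with base $BC$. *)

(* Defs.v *)
From Stdlib Require Import Reals List Sorted.
Import ListNotations.
Open Scope R_scope.

Definition point : Type := (R * R)%type.

Definition dist (P Q : point) : R :=
  sqrt ((fst P - fst Q) ^ 2 + (snd P - snd Q) ^ 2).

Definition area (a b c : R) : R :=
  let s := (a + b + c) / 2 in sqrt (s * (s - a) * (s - b) * (s - c)).

(* A triangle center is given, as in ETC, by the first barycentric coordinate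
   f(a,b,c); the full coordinates are f(a,b,c) : f(b,c,a) : f(c,a,b). *)
Definition center_fun : Type := R -> R -> R -> R.

Definition center (f : center_fun) (A B C : point) : point :=
  let a := dist B C in let b := dist C A in let c := dist A B in
  let u := f a b c in let v := f b c a in let w := f c a b in
  let s := u + v + w in
  ((u * fst A + v * fst B + w * fst C) / s,
   (u * snd A + v * snd B + w * snd C) / s).

(* ETC barycentric coordinates (first coordinate). *)
Definition X1  : center_fun := fun a b c => a.
Definition X2  : center_fun := fun a b c => 1.
Definition X3  : center_fun := fun a b c => a^2 * (b^2 + c^2 - a^2).
Definition X4  : center_fun := fun a b c => (a^2 + b^2 - c^2) * (a^2 - b^2 + c^2).
Definition X5  : center_fun := fun a b c => a^2 * (b^2 + c^2) - (b^2 - c^2)^2.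
Definition X6  : center_fun := fun a b c => a^2.
Definition X7  : center_fun := fun a b c => (a + b - c) * (a - b + c).
Definition X8  : center_fun := fun a b c => b + c - a.
Definition X9  : center_fun := fun a b c => a * (b + c - a).
Definition X10 : center_fun := fun a b c => b + c.
Definition X11 : center_fun := fun a b c => (b + c - a) * (b - c)^2.
Definition X12 : center_fun := fun a b c => (b + c)^2 / (b + c - a).
Definition X13 : center_fun := fun a b c =>
  a^4 - 2 * (b^2 - c^2)^2 + a^2 * (b^2 + c^2 + 4 * sqrt 3 * area a b c).
Definition X14 : center_fun := fun a b c =>
  a^4 - 2 * (b^2 - c^2)^2 + a^2 * (b^2 + c^2 - 4 * sqrt 3 * area a b c).
Definition X16 : center_fun := fun a b c =>
  a^2 * (sqrt 3 * (a^2 - b^2 - c^2) + 4 * area a b c).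
Definition X17 : center_fun := fun a b c =>
  / (b^2 + c^2 - a^2 + 4 * sqrt 3 * area a b c).
Definition X19 : center_fun := fun a b c => a / (b^2 + c^2 - a^2).
Definition X20 : center_fun := fun a b c =>
  3 * a^4 - 2 * a^2 * (b^2 + c^2) - (b^2 - c^2)^2.
Definition X21 : center_fun := fun a b c => a * (b + c - a) / (b + c).
Definition X22 : center_fun := fun a b c => a^2 * (b^4 + c^4 - a^4).
Definition X23 : center_fun := fun a b c => a^2 * (b^4 + c^4 - a^4 - b^2 * c^2).
Definition X25 : center_fun := fun a b c => a^2 / (b^2 + c^2 - a^2).
Definition X27 : center_fun := fun a b c => / ((b + c) * (b^2 + c^2 - a^2)).
Definition X28 : center_fun := fun a b c => a / ((b + c) * (b^2 + c^2 - a^2)).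

Definition tall_isosceles (A B C : point) : Prop :=
  (fst B - fst A) * (snd C - snd A) - (snd B - snd A) * (fst C - fst A) <> 0 /\
  dist A B = dist A C /\ dist B C < dist A C.

Definition iso_prec (P Q : center_fun) : Prop :=
  forall A B C : point, tall_isosceles A B C ->
    dist A (center P A B C) < dist A (center Q A B C).

(* Main.v *)
(* In an isosceles triangle with base [a] and legs [b] every listed center lies
   on the axis of symmetry, at [A + t (M - A)] with [M] the midpoint of the base,
   so the theorem compares the ratios [t >= 0], which are functions of [a] and
   [b] alone.  The irrational term [sqrt 3 * area] equals [a * z / 4] with
   [z = sqrt (12 b^2 - 3 a^2) > 3 a]; after clearing denominators each
   comparison is a polynomial inequality in [a], [b - a > 0] and [z]. *)
From Stdlib Require Import Reals List Sorted Lra.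
Require Import Defs.
Import ListNotations.

(** * Reduction to ratios along the axis of symmetry *)

Lemma dist_sym (P Q : point) : dist P Q = dist Q P.
Proof. unfold dist; f_equal; ring. Qed.

Lemma dist_pos (P Q : point) : P <> Q -> 0 < dist P Q.
Proof.
  destruct P as [x y], Q as [x' y']; intros HPQ; apply sqrt_lt_R0;
    cbn [fst snd].
  pose proof (pow2_ge_0 (x - x')); pose proof (pow2_ge_0 (y - y')).
  destruct (Req_dec x x') as [-> | Nx].
  - assert (0 < Rsqr (y - y')).
    { apply Rsqr_pos_lt; intros E; apply HPQ; f_equal; lra. }
    rewrite <- !Rsqr_pow2 in *; lra.
  - assert (0 < Rsqr (x - x')) by (apply Rsqr_pos_lt; lra).
    rewrite <- !Rsqr_pow2 in *; lra.
Qed.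

Definition midpoint (P Q : point) : point :=
  ((fst P + fst Q) / 2, (snd P + snd Q) / 2).

(** The factor [k] is the sum of the three coordinates, and [t] is the share of it carried by [B]
    and [C] together. Coordinates being homogeneous, [k] may have either sign. *)
Definition axis_ratio (f : center_fun) (t : R -> R -> R) : Prop :=
  forall a b : R, 0 < a -> a < b ->
    0 <= t a b /\
    exists k, k <> 0 /\ f a b b = k * (1 - t a b) /\
      f b b a = k * (t a b / 2) /\ f b a b = k * (t a b / 2).

(** The coordinates sum to [k], so after division the center is [(1 - t) A + t M] with [M] the
    midpoint of [BC]; [0 <= t] lets [t] leave the square root without an absolute value. *)
Lemma dist_center_axis (f : center_fun) (A B C : point) (k t : R) :
  let a := dist B C in let b := dist C A in
  dist A B = b -> 0 <= t -> k <> 0 -> f a b b = k * (1 - t) ->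
  f b b a = k * (t / 2) -> f b a b = k * (t / 2) ->
  dist A (center f A B C) = t * dist A (midpoint B C).
Proof.
  intros a b Hc Ht Hk Hu Hv Hw.
  unfold center; fold a; rewrite Hc; fold b; rewrite Hu, Hv, Hw.
  unfold dist, midpoint; cbn [fst snd].
  symmetry; rewrite <- (sqrt_pow2 t Ht) at 1.
  rewrite <- sqrt_mult_alt by apply pow2_ge_0.
  f_equal; field; lra.
Qed.

Lemma tall_isosceles_midpoint (A B C : point) :
  tall_isosceles A B C -> 0 < dist A (midpoint B C).
Proof.
  intros [Hnd _]; apply dist_pos; intros ->; apply Hnd.
  unfold midpoint; cbn [fst snd]; field.
Qed.

Lemma tall_isosceles_base (A B C : point) :
  tall_isosceles A B C -> 0 < dist B C.
Proof. intros [Hnd _]; apply dist_pos; intros ->; apply Hnd; ring. Qed.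

(** Both distances are multiples of the same length [AM], which is positive because the triangle is
    nondegenerate. *)
Lemma iso_prec_of_axis_ratio (P Q : center_fun) (p q : R -> R -> R) :
  axis_ratio P p -> axis_ratio Q q ->
  (forall a b, 0 < a -> a < b -> p a b < q a b) -> iso_prec P Q.
Proof.
  intros HP HQ Hpq A B C H.
  pose proof (tall_isosceles_midpoint _ _ _ H) as Hm.
  pose proof (tall_isosceles_base _ _ _ H) as Ha.
  destruct H as (_ & Hiso & Hab).
  rewrite (dist_sym A C) in Hiso, Hab.
  destruct (HP _ _ Ha Hab) as (Hp & k & Hk & Hu & Hv & Hw).
  destruct (HQ _ _ Ha Hab) as (Hq & l & Hl & Hu' & Hv' & Hw').
  rewrite (dist_center_axis P A B C k _ Hiso Hp Hk Hu Hv Hw).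
  rewrite (dist_center_axis Q A B C l _ Hiso Hq Hl Hu' Hv' Hw').
  apply Rmult_lt_compat_r; auto.
Qed.

(** * The area of an isosceles triangle and the surd [z] *)

Lemma area_swap12 (a b c : R) : area a b c = area b a c.
Proof. unfold area; f_equal; field. Qed.

Lemma area_swap23 (a b c : R) : area a b c = area a c b.
Proof. unfold area; f_equal; field. Qed.

(** This is [2 * sqrt 3] times the altitude from [A]. *)
Definition z (a b : R) : R := sqrt (12 * b ^ 2 - 3 * a ^ 2).

Lemma z_sqr (a b : R) : 0 < a -> a < b -> z a b ^ 2 = 12 * b ^ 2 - 3 * a ^ 2.
Proof. intros; unfold z; rewrite pow2_sqrt; nra. Qed.

Lemma z_gt (a b : R) : 0 < a -> a < b -> 3 * a < z a b.
Proof.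
  intros; pose proof (z_sqr a b H H0).
  pose proof (sqrt_pos (12 * b ^ 2 - 3 * a ^ 2)); fold (z a b) in *; nra.
Qed.

(** The squares differ by [4 (b - a) (2 b + a)]. This bound decides the comparisons of [X17] with
    [X1], [X1] with [X13], and [X14] with [X16]. *)
Lemma z_gt_perimeter (a b : R) : 0 < a -> a < b -> a + 2 * b < z a b.
Proof.
  intros Ha Hab; pose proof (z_sqr a b Ha Hab); pose proof (z_gt a b Ha Hab);
    nra.
Qed.

Lemma area_isosceles (a b : R) :
  0 < a -> a < b -> area a b b = sqrt 3 * a * z a b / 12.
Proof.
  intros Ha Hab.
  pose proof (z_sqr a b Ha Hab) as Hz; pose proof (z_gt a b Ha Hab) as Hgt.
  pose proof (pow2_sqrt 3 ltac:(lra)) as H3; pose proof (sqrt_pos 3) as Hs.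
  unfold area; apply sqrt_lem_1.
  - replace (_ * _) with (a ^ 2 * (4 * b ^ 2 - a ^ 2) / 16) by field; nra.
  - assert (0 <= sqrt 3 * a * z a b) by (repeat apply Rmult_le_pos; lra); lra.
  - replace (_ * _) with (sqrt 3 ^ 2 * a ^ 2 * z a b ^ 2 / 144) by field.
    rewrite Hz, H3; field.
Qed.

Lemma sqrt3_area_isosceles (a b : R) :
  0 < a -> a < b -> 4 * sqrt 3 * area a b b = a * z a b.
Proof.
  intros Ha Hab; rewrite area_isosceles by assumption.
  replace (_ * _) with (sqrt 3 ^ 2 * (a * z a b) / 3) by field.
  rewrite pow2_sqrt by lra; field.
Qed.

(** * Tactics for polynomial positivity and rational ratios *)

Ltac positivity :=
  lazymatch goal with
  | |- 0 < _ + _ => apply Rplus_lt_0_compat; positivity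
  | |- 0 < _ * _ => apply Rmult_lt_0_compat; positivity
  | |- 0 < _ / _ => apply Rdiv_lt_0_compat; positivity
  | |- 0 < _ ^ _ => apply pow_lt; positivity
  | |- 0 < _ => first [ assumption | lra ]
  end.

Ltac expand_positivity := ring_simplify; positivity.

(* Writing [b = a + d] turns the polynomials below into polynomials in the
   positive reals [a] and [d] with positive coefficients. *)
Ltac intros_sides :=
  let a := fresh "a" in let b := fresh "b" in
  let d := fresh "d" in let Hab := fresh in
  intros a b ? Hab;
  assert (exists d, 0 < d /\ b = a + d) as (d & ? & ->)
    by (exists (b - a); lra);
  clear Hab.

(** Given factorizations are kept: only factors that are not themselves products, quotients or
    powers get expanded. *)
Ltac prove_pos :=
  lazymatch goal with
  | |- 0 < _ * _ => apply Rmult_lt_0_compat; prove_pos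
  | |- 0 < _ / _ => apply Rdiv_lt_0_compat; prove_pos
  | |- 0 < _ ^ _ => apply pow_lt; prove_pos
  | |- 0 < _ => first [ assumption | expand_positivity ]
  end.

Ltac nonzero := repeat split; apply Rgt_not_eq; unfold Rgt; prove_pos.

(** Here [scale] supplies the coordinate sum [k]. The second attempt at [k <> 0] serves [X20] and
    [X23], where that sum is negative. *)
Ltac rational_ratio f scale :=
  intros_sides; split;
  [ apply Rlt_le; prove_pos
  | lazymatch goal with
    | |- exists k, _ /\ f ?a ?b _ = _ /\ _ => exists (scale a b)
    end;
    cbv beta; split;
    [ first
        [ solve [ nonzero ]
        | apply Rlt_not_eq, Ropp_lt_cancel; rewrite Ropp_0; prove_pos ]
    | unfold f; repeat split; field; nonzero ] ].

(** * The ratio of each center *)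

Lemma X20_ratio : axis_ratio X20
  (fun a b => 2 * a ^ 2 / (4 * b ^ 2 - a ^ 2)).
Proof.
  rational_ratio X20 (fun a b : R => - (a ^ 2 * (4 * b ^ 2 - a ^ 2))).
Qed.

Lemma X22_ratio : axis_ratio X22
  (fun a b => 2 * a ^ 2 * b ^ 2 / (2 * b ^ 4 + 2 * a ^ 2 * b ^ 2 - a ^ 4)).
Proof.
  rational_ratio X22
    (fun a b : R => a ^ 2 * (2 * b ^ 4 + 2 * a ^ 2 * b ^ 2 - a ^ 4)).
Qed.

Lemma X8_ratio : axis_ratio X8
  (fun a b => 2 * a / (a + 2 * b)).
Proof.
  rational_ratio X8 (fun a b : R => a + 2 * b).
Qed.

Lemma X3_ratio : axis_ratio X3
  (fun a b => 2 * b ^ 2 / (4 * b ^ 2 - a ^ 2)).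
Proof.
  rational_ratio X3 (fun a b : R => a ^ 2 * (4 * b ^ 2 - a ^ 2)).
Qed.

Lemma X9_ratio : axis_ratio X9
  (fun a b => 2 * b / (4 * b - a)).
Proof.
  rational_ratio X9 (fun a b : R => a * (4 * b - a)).
Qed.

Lemma X10_ratio : axis_ratio X10
  (fun a b => (a + b) / (a + 2 * b)).
Proof.
  rational_ratio X10 (fun a b : R => 2 * (a + 2 * b)).
Qed.

Lemma X21_ratio : axis_ratio X21
  (fun a b => 4 * b ^ 2 / (6 * b ^ 2 + a * b - a ^ 2)).
Proof.
  rational_ratio X21
    (fun a b : R => a * (6 * b ^ 2 + a * b - a ^ 2) / (2 * b * (a + b))).
Qed.

Lemma X2_ratio : axis_ratio X2
  (fun a b => 2 / 3).
Proof.
  rational_ratio X2 (fun a b : R => 3).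
Qed.

Lemma X5_ratio : axis_ratio X5
  (fun a b => (3 * b ^ 2 - a ^ 2) / (4 * b ^ 2 - a ^ 2)).
Proof.
  rational_ratio X5 (fun a b : R => 2 * a ^ 2 * (4 * b ^ 2 - a ^ 2)).
Qed.

Lemma X12_ratio : axis_ratio X12
  (fun a b => (a + b) ^ 2 * (2 * b - a) / (2 * b ^ 3 + 5 * a * b ^ 2 - a ^ 3)).
Proof.
  rational_ratio X12
    (fun a b : R => 2 * (2 * b ^ 3 + 5 * a * b ^ 2 - a ^ 3)
      / (a * (2 * b - a))).
Qed.

Lemma X17_ratio : axis_ratio X17
  (fun a b => 2 * (2 * b ^ 2 - a ^ 2 + a * z a b)
    / (4 * b ^ 2 - a ^ 2 + 3 * a * z a b)).
Proof.
  intros a b Ha Hab; pose proof (z_gt a b Ha Hab) as Hz.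
  assert (0 < a * z a b) by (apply Rmult_lt_0_compat; lra).
  assert (0 < 2 * b ^ 2 - a ^ 2) by nra.
  split; [ apply Rlt_le, Rdiv_lt_0_compat; nra | ].
  (* This is [u + 2 v] for [u = 1 / (2 b^2 - a^2 + a z)] at [A] and [v = 1 / (a^2 + a z)] at [B] and
     [C]. *)
  exists ((4 * b ^ 2 - a ^ 2 + 3 * a * z a b)
    / ((a ^ 2 + a * z a b) * (2 * b ^ 2 - a ^ 2 + a * z a b))); unfold X17.
  rewrite (area_swap23 b b a), (area_swap12 b a b),
    sqrt3_area_isosceles by assumption.
  split; [ apply Rgt_not_eq, Rdiv_lt_0_compat; nra | ].
  repeat split; field; repeat split; nra.
Qed.

Lemma X1_ratio : axis_ratio X1
  (fun a b => 2 * b / (a + 2 * b)).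
Proof.
  rational_ratio X1 (fun a b : R => a + 2 * b).
Qed.

(** The first Fermat point sees [BC] under 120 degrees, so its height above [BC] is
    [a / (2 sqrt 3)], while the altitude is [z / (2 sqrt 3)]. Algebraically, the coordinate at [A]
    is [a^2 (a^2 + 2 b^2 + a z)], and [z_sqr] turns the sum into [a z (a^2 + 2 b^2 + a z)]. *)
Lemma X13_ratio : axis_ratio X13
  (fun a b => 1 - a / z a b).
Proof.
  intros a b Ha Hab.
  pose proof (z_gt a b Ha Hab) as Hz; pose proof (z_sqr a b Ha Hab) as Hz2.
  assert (0 < a * z a b) by (apply Rmult_lt_0_compat; lra).
  split; [ | exists (a * z a b * (a ^ 2 + 2 * b ^ 2 + a * z a b)); unfold X13 ].
  - replace (1 - _) with ((z a b - a) / z a b) by (field; lra).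
    apply Rlt_le, Rdiv_lt_0_compat; lra.
  - rewrite (area_swap23 b b a), (area_swap12 b a b),
      sqrt3_area_isosceles by assumption.
    split; [ apply Rgt_not_eq; nra | ].
    (* Cancelling the denominator exposes [z^2], which [z_sqr] then eliminates. *)
    replace (_ * ((1 - a / z a b) / 2))
      with (a * (2 * b ^ 2 * z a b - a ^ 3 - 2 * a * b ^ 2 + a * z a b ^ 2) / 2)
      by (field; lra).
    rewrite Hz2; repeat split; field; lra.
Qed.

Lemma X7_ratio : axis_ratio X7
  (fun a b => 2 * (2 * b - a) / (4 * b - a)).
Proof.
  rational_ratio X7 (fun a b : R => a * (4 * b - a)).
Qed.

Lemma X6_ratio : axis_ratio X6
  (fun a b => 2 * b ^ 2 / (a ^ 2 + 2 * b ^ 2)).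
Proof.
  rational_ratio X6 (fun a b : R => a ^ 2 + 2 * b ^ 2).
Qed.

Lemma X4_ratio : axis_ratio X4
  (fun a b => 2 * (2 * b ^ 2 - a ^ 2) / (4 * b ^ 2 - a ^ 2)).
Proof.
  rational_ratio X4 (fun a b : R => a ^ 2 * (4 * b ^ 2 - a ^ 2)).
Qed.

Lemma X27_ratio : axis_ratio X27
  (fun a b => 4 * b * (2 * b ^ 2 - a ^ 2)
    / ((a + b) * a ^ 2 + 4 * b * (2 * b ^ 2 - a ^ 2))).
Proof.
  rational_ratio X27
    (fun a b : R => ((a + b) * a ^ 2 + 4 * b * (2 * b ^ 2 - a ^ 2))
      / (2 * a ^ 2 * b * (a + b) * (2 * b ^ 2 - a ^ 2))).
Qed.

Lemma X19_ratio : axis_ratio X19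
  (fun a b => 2 * b * (2 * b ^ 2 - a ^ 2)
    / (a ^ 3 + 2 * b * (2 * b ^ 2 - a ^ 2))).
Proof.
  rational_ratio X19
    (fun a b : R => (a ^ 3 + 2 * b * (2 * b ^ 2 - a ^ 2))
      / (a ^ 2 * (2 * b ^ 2 - a ^ 2))).
Qed.

Lemma X28_ratio : axis_ratio X28
  (fun a b => 4 * b ^ 2 * (2 * b ^ 2 - a ^ 2)
    / (a ^ 3 * (a + b) + 4 * b ^ 2 * (2 * b ^ 2 - a ^ 2))).
Proof.
  rational_ratio X28
    (fun a b : R => (a ^ 3 * (a + b) + 4 * b ^ 2 * (2 * b ^ 2 - a ^ 2))
      / (2 * a ^ 2 * b * (a + b) * (2 * b ^ 2 - a ^ 2))).
Qed.

Lemma X25_ratio : axis_ratio X25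
  (fun a b => 2 * b ^ 2 * (2 * b ^ 2 - a ^ 2)
    / (a ^ 4 + 2 * b ^ 2 * (2 * b ^ 2 - a ^ 2))).
Proof.
  rational_ratio X25
    (fun a b : R => (a ^ 4 + 2 * b ^ 2 * (2 * b ^ 2 - a ^ 2))
      / (a ^ 2 * (2 * b ^ 2 - a ^ 2))).
Qed.

(** The factor [(b - c)^2] kills the coordinate at [A]: the Feuerbach point is the midpoint of the
    base. *)
Lemma X11_ratio : axis_ratio X11
  (fun a b => 1).
Proof.
  rational_ratio X11 (fun a b : R => 2 * a * (b - a) ^ 2).
Qed.

(** The second Fermat point mirrors the first in the line [BC], which changes the sign of [z] in the
    formulas. *)
Lemma X14_ratio : axis_ratio X14
  (fun a b => 1 + a / z a b).
Proof.
  intros a b Ha Hab.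
  pose proof (z_gt a b Ha Hab) as Hz; pose proof (z_sqr a b Ha Hab) as Hz2.
  assert (0 < a * z a b) by (apply Rmult_lt_0_compat; lra).
  split; [ | exists (- (a * z a b * (a ^ 2 + 2 * b ^ 2 - a * z a b)));
    unfold X14 ].
  - assert (0 < a / z a b) by (apply Rdiv_lt_0_compat; lra); lra.
  - rewrite (area_swap23 b b a), (area_swap12 b a b),
      sqrt3_area_isosceles by assumption.
    (* The last factor is positive because [(a^2 + 2 b^2)^2 - a^2 z^2 = 4 (b^2 - a^2)^2]. *)
    split; [ apply Rlt_not_eq, Ropp_lt_gt_0_contravar;
      apply Rmult_lt_0_compat; nra | ].
    replace (_ * ((1 + a / z a b) / 2))
      with (- a
        * (2 * b ^ 2 * z a b + a ^ 3 + 2 * a * b ^ 2 - a * z a b ^ 2) / 2)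
      by (field; lra).
    rewrite Hz2; repeat split; field; lra.
Qed.

Lemma X16_ratio : axis_ratio X16
  (fun a b => 4 * b ^ 2 / (4 * b ^ 2 - a ^ 2 - a * z a b)).
Proof.
  intros a b Ha Hab.
  pose proof (z_gt a b Ha Hab) as Hz; pose proof (z_sqr a b Ha Hab) as Hz2.
  (* Since [4 b^2 - a^2 = z^2 / 3], this is [z (z - 3 a) / 3]. *)
  assert (0 < 4 * b ^ 2 - a ^ 2 - a * z a b) by nra.
  split; [ apply Rlt_le, Rdiv_lt_0_compat; nra | ].
  (* All three coordinates share the factor [sqrt 3 * a * (z - 3 a)]; the one at [A] is
     [- sqrt 3 * a^2 (z - 3 a) (z + a) / 6]. *)
  exists (sqrt 3 * a * (z a b - 3 * a) * (4 * b ^ 2 - a ^ 2 - a * z a b) / 6).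
  unfold X16.
  rewrite (area_swap23 b b a), (area_swap12 b a b),
    area_isosceles by assumption.
  split.
  - apply Rgt_not_eq, Rdiv_lt_0_compat; [ | lra ].
    repeat apply Rmult_lt_0_compat; try lra; apply sqrt_lt_R0; lra.
  - repeat split; try (field; lra).
    replace (_ / 6 * _)
      with (sqrt 3 * a * (3 * a ^ 3 + 2 * a ^ 2 * z a b - a * z a b ^ 2) / 6)
      by (field; lra).
    rewrite Hz2; field.
Qed.

Lemma X23_ratio : axis_ratio X23
  (fun a b => 2 * b ^ 2 / (b ^ 2 - a ^ 2)).
Proof.
  rational_ratio X23 (fun a b : R => - (a ^ 2 * (b ^ 2 - a ^ 2) ^ 2)).
Qed.

(** * Comparison of consecutive ratios *)

Lemma Rdiv_lt_cross (n m p q : R) :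
  0 < m -> 0 < q -> n * q < p * m -> n / m < p / q.
Proof.
  intros Hm Hq H; apply Rmult_lt_reg_r with (m * q); [ nra | ].
  replace (n / m * (m * q)) with (n * q) by (field; lra).
  replace (p / q * (m * q)) with (p * m) by (field; lra).
  assumption.
Qed.

(** When both ratios are rational, the cross-multiplied difference has only positive coefficients in
    [a] and [d = b - a]. *)
Ltac rational_lt P Q :=
  apply (iso_prec_of_axis_ratio _ _ _ _ P Q);
  intros_sides;
  apply Rdiv_lt_cross;
    [ prove_pos | prove_pos | apply Rlt_0_minus; expand_positivity ].

(* What [X12 < X17] amounts to after division by [a * (b - a)]; both sides agree
   at [a = b]. *)
Lemma z_lt_cubic (a b : R) : 0 < a -> a < b ->
  z a b * (2 * b ^ 2 + a * b + a ^ 2)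
  < 8 * b ^ 3 + 6 * a * b ^ 2 - a ^ 2 * b - a ^ 3.
Proof.
  intros Ha Hab; apply Rsqr_incrst_0.
  - rewrite Rsqr_mult, !Rsqr_pow2, (z_sqr a b Ha Hab).
    revert a b Ha Hab; intros_sides; apply Rlt_0_minus; expand_positivity.
  - pose proof (z_gt a b Ha Hab); apply Rmult_le_pos; nra.
  - apply Rlt_le; revert a b Ha Hab; intros_sides; prove_pos.
Qed.

Lemma prec_X20_X22 : iso_prec X20 X22.
Proof.
  rational_lt X20_ratio X22_ratio.
Qed.

Lemma prec_X22_X8 : iso_prec X22 X8.
Proof.
  rational_lt X22_ratio X8_ratio.
Qed.

Lemma prec_X8_X3 : iso_prec X8 X3.
Proof.
  rational_lt X8_ratio X3_ratio.
Qed.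

Lemma prec_X3_X9 : iso_prec X3 X9.
Proof.
  rational_lt X3_ratio X9_ratio.
Qed.

Lemma prec_X9_X10 : iso_prec X9 X10.
Proof.
  rational_lt X9_ratio X10_ratio.
Qed.

Lemma prec_X10_X21 : iso_prec X10 X21.
Proof.
  rational_lt X10_ratio X21_ratio.
Qed.

Lemma prec_X21_X2 : iso_prec X21 X2.
Proof.
  rational_lt X21_ratio X2_ratio.
Qed.

Lemma prec_X2_X5 : iso_prec X2 X5.
Proof.
  rational_lt X2_ratio X5_ratio.
Qed.

Lemma prec_X5_X12 : iso_prec X5 X12.
Proof.
  rational_lt X5_ratio X12_ratio.
Qed.

Lemma prec_X12_X17 : iso_prec X12 X17.
Proof.
  apply (iso_prec_of_axis_ratio _ _ _ _ X12_ratio X17_ratio).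
  intros a b Ha Hab; pose proof (z_gt a b Ha Hab) as Hz.
  pose proof (z_lt_cubic a b Ha Hab) as Hz'.
  apply Rdiv_lt_cross.
  - clear Hz Hz'; revert a b Ha Hab; intros_sides; prove_pos.
  - nra.
  - apply Rlt_0_minus.
    replace (_ - _) with (a * (b - a)
      * (8 * b ^ 3 + 6 * a * b ^ 2 - a ^ 2 * b - a ^ 3
         - z a b * (2 * b ^ 2 + a * b + a ^ 2))) by ring.
    repeat apply Rmult_lt_0_compat; lra.
Qed.

Lemma prec_X17_X1 : iso_prec X17 X1.
Proof.
  apply (iso_prec_of_axis_ratio _ _ _ _ X17_ratio X1_ratio).
  intros a b Ha Hab; pose proof (z_gt_perimeter a b Ha Hab) as Hz.
  apply Rdiv_lt_cross; [ nra | lra | apply Rlt_0_minus ].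
  replace (_ - _) with (2 * a * (b - a) * (z a b - (a + 2 * b))) by ring.
  repeat apply Rmult_lt_0_compat; lra.
Qed.

Lemma prec_X1_X13 : iso_prec X1 X13.
Proof.
  apply (iso_prec_of_axis_ratio _ _ _ _ X1_ratio X13_ratio).
  intros a b Ha Hab; pose proof (z_gt_perimeter a b Ha Hab) as Hz.
  replace (1 - a / z a b) with ((z a b - a) / z a b) by (field; lra).
  apply Rdiv_lt_cross; nra.
Qed.

Lemma prec_X13_X7 : iso_prec X13 X7.
Proof.
  apply (iso_prec_of_axis_ratio _ _ _ _ X13_ratio X7_ratio).
  intros a b Ha Hab.
  pose proof (z_gt a b Ha Hab) as Hz; pose proof (z_sqr a b Ha Hab) as Hz2.
  (* The ratio of [X7] is [1 - a / (4 b - a)], so this bound is the whole claim; it holds because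
     [(4 b - a)^2 - z^2 = 4 (b - a)^2]. *)
  assert (z a b < 4 * b - a) by nra.
  replace (1 - a / z a b) with ((z a b - a) / z a b) by (field; lra).
  apply Rdiv_lt_cross; nra.
Qed.

Lemma prec_X7_X6 : iso_prec X7 X6.
Proof.
  rational_lt X7_ratio X6_ratio.
Qed.

Lemma prec_X6_X4 : iso_prec X6 X4.
Proof.
  rational_lt X6_ratio X4_ratio.
Qed.

Lemma prec_X4_X27 : iso_prec X4 X27.
Proof.
  rational_lt X4_ratio X27_ratio.
Qed.

Lemma prec_X27_X19 : iso_prec X27 X19.
Proof.
  rational_lt X27_ratio X19_ratio.
Qed.

Lemma prec_X19_X28 : iso_prec X19 X28.
Proof.
  rational_lt X19_ratio X28_ratio.
Qed.

Lemma prec_X28_X25 : iso_prec X28 X25.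
Proof.
  rational_lt X28_ratio X25_ratio.
Qed.

Lemma prec_X25_X11 : iso_prec X25 X11.
Proof.
  apply (iso_prec_of_axis_ratio _ _ _ _ X25_ratio X11_ratio).
  intros_sides; rewrite <- (Rdiv_1_r 1).
  apply Rdiv_lt_cross;
    [ prove_pos | lra | apply Rlt_0_minus; expand_positivity ].
Qed.

Lemma prec_X11_X14 : iso_prec X11 X14.
Proof.
  apply (iso_prec_of_axis_ratio _ _ _ _ X11_ratio X14_ratio).
  intros a b Ha Hab.
  pose proof (z_gt a b Ha Hab) as Hz; pose proof (z_sqr a b Ha Hab) as Hz2.
  assert (0 < a / z a b) by (apply Rdiv_lt_0_compat; lra); lra.
Qed.

Lemma prec_X14_X16 : iso_prec X14 X16.
Proof.
  apply (iso_prec_of_axis_ratio _ _ _ _ X14_ratio X16_ratio).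
  intros a b Ha Hab; pose proof (z_sqr a b Ha Hab) as Hz2.
  pose proof (z_gt_perimeter a b Ha Hab) as Hz.
  replace (1 + a / z a b) with ((z a b + a) / z a b) by (field; lra).
  apply Rdiv_lt_cross; [ lra | nra | apply Rlt_0_minus ].
  (* The terms in [b^2 z] cancel, leaving [a ((z + a)^2 - 4 b^2)]. *)
  replace (_ - _) with (a * (z a b + a - 2 * b) * (z a b + a + 2 * b)) by ring.
  repeat apply Rmult_lt_0_compat; lra.
Qed.

Lemma prec_X16_X23 : iso_prec X16 X23.
Proof.
  apply (iso_prec_of_axis_ratio _ _ _ _ X16_ratio X23_ratio).
  intros a b Ha Hab.
  pose proof (z_gt a b Ha Hab) as Hz; pose proof (z_sqr a b Ha Hab) as Hz2.
  apply Rdiv_lt_cross; [ nra | nra | apply Rlt_0_minus ].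
  (* The second summand vanishes by [z_sqr]; modulo that relation the difference is a multiple of a
     square, nonzero since [3 a < z]. *)
  replace (_ - _) with (b ^ 2 * (z a b - 3 * a) ^ 2 / 3
    + b ^ 2 * (12 * b ^ 2 - 3 * a ^ 2 - z a b ^ 2) / 3) by field.
  rewrite Hz2, Rminus_diag, Rmult_0_r, Rdiv_0_l, Rplus_0_r.
  apply Rdiv_lt_0_compat; [ | lra ].
  apply Rmult_lt_0_compat; apply pow_lt; lra.
Qed.

Theorem theorem3p1 :
  Sorted iso_prec
    [X20; X22; X8; X3; X9; X10; X21; X2; X5; X12; X17; X1;
     X13; X7; X6; X4; X27; X19; X28; X25; X11; X14; X16; X23].
Proof.
  repeat constructor; auto using
    prec_X20_X22, prec_X22_X8, prec_X8_X3, prec_X3_X9, prec_X9_X10,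
    prec_X10_X21, prec_X21_X2, prec_X2_X5, prec_X5_X12, prec_X12_X17,
    prec_X17_X1, prec_X1_X13, prec_X13_X7, prec_X7_X6, prec_X6_X4,
    prec_X4_X27, prec_X27_X19, prec_X19_X28, prec_X28_X25, prec_X25_X11,
    prec_X11_X14, prec_X14_X16, prec_X16_X23.
Qed.
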